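(* Let $k\geq3$ be an integer and let $\zeta_k$ be a primitive $k$-th root of unity. Then there is an effectively computable constant $C(k)$, depending only on $k$, such that the algebraic integers $-m+\zeta_k$ and $-n+\zeta_k$ are multiplicatively independent for all integers $m>n>C(k)$. Moreover, if $k$ is a power of $2,3,5,6,7,11,13,17,19$ or $23$, then $-m+\zeta_k$ and $-n+\zeta_k$ are multiplicatively independent for all integers $m>n>0$ when $k\neq6$, and for all integers $m>n>1$ when $k=6$.
   Context: Two algebraic integers $\alpha$ and $\beta$ are called multiplicatively independent if the equation $\alpha^p=\beta^q$ has only the solution $p=q=0$ in integers $p,q$. *)

(* Defs.v *)
From mathcomp Require Import all_boot all_order all_algebra all_field.

Set Implicit Arguments.
Unset Strict Implicit.
Unset Printing Implicit Defensive.

Import GRing.Theory Num.Theory.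
Local Open Scope ring_scope.

(* Only meant for nonzero a and b, since exprz gives 0 ^ p = 0 for p < 0. *)
Definition mult_independent (a b : algC) : Prop :=
  [/\ a \in Aint, b \in Aint &
      forall p q : int, a ^ p = b ^ q -> p = 0 /\ q = 0].

(* Total recursive functions in Kleene's sense. Minimisation is restricted to
   its regular instances (a zero exists for every argument), which does not
   change the class of total functions obtained. *)
Inductive recursive : forall n : nat, (n.-tuple nat -> nat) -> Prop :=
| recursive_zero n : @recursive n (fun=> 0%N)
| recursive_succ : @recursive 1 (fun v => (thead v).+1)
| recursive_proj n (i : 'I_n) : @recursive n (fun v => tnth v i)
| recursive_comp m n (f : m.-tuple nat -> nat)
    (g : 'I_m -> n.-tuple nat -> nat) :
    recursive f -> (forall i, recursive (g i)) ->
    @recursive n (fun v => f [tuple g i v | i < m])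
| recursive_primrec n (f : n.-tuple nat -> nat) (g : n.+2.-tuple nat -> nat)
    (h : n.+1.-tuple nat -> nat) :
    recursive f -> recursive g ->
    (forall v : n.-tuple nat, h [tuple of 0%N :: v] = f v) ->
    (forall j (v : n.-tuple nat),
       h [tuple of j.+1 :: v] =
       g [tuple of j :: h [tuple of j :: v] :: v]) ->
    recursive h
| recursive_mu n (f : n.+1.-tuple nat -> nat) (h : n.-tuple nat -> nat) :
    recursive f ->
    (forall v : n.-tuple nat, f [tuple of h v :: v] = 0%N) ->
    (forall (v : n.-tuple nat) j,
       (j < h v)%N -> f [tuple of j :: v] <> 0%N) ->
    recursive h.

Definition effectively_computable (C : nat -> nat) : Prop :=
  recursive (fun v : 1.-tuple nat => C (thead v)).

(* Main.v *)
(* Applying Galois automorphisms, (zeta - m)^p = (zeta - n)^q gives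
   |m - z|^p = |n - z|^q for every conjugate z of zeta, where
   |m - z|^2 = m^2 + 1 - m t with t = z + 1/z.  If two conjugates have different
   traces t1 < t2, the quotient (m^2+1-m t1) / (m^2+1-m t2) is smaller for m than
   for n < m, which forces |q| < |p|, while the norm grows with m and is at least
   1 at n, which forces |p| < |q|; so p = q = 0.  This covers k <> 3, 4, 6.

   For k = 3, 4, 6 the numbers are, up to sign, m + theta and n + theta with
   n >= 1, in Z[theta] where theta^2 = c theta - 1 and c is 0 or 1.  Euclid's
   algorithm on (p, q) writes them as theta^j z^a and theta^k z^b with a, b
   coprime and a > b, and a, b are odd because m^2 + c m + 1 is not a square.
   If 3 does not divide a (or c = 0), theta^j can be absorbed in z, so that
   z = +-(x + theta) and the theta-coordinate of (x + theta)^a is +-1; a 2-adic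
   analysis of that coordinate excludes a > 1.  Hence c = 1, 3 divides a, and
   applying the same to b gives b = 1; the 2-adic analysis now leaves only
   a = 3, n = 2, coming from 18^2 + 18 + 1 = (2^2 + 2 + 1)^3, which corresponds
   to m = -19 < 0. *)

Require Import Defs.
From HB Require Import structures.
From mathcomp Require Import all_boot all_order all_algebra all_field.
From mathcomp Require Import zify ring.

Set Implicit Arguments.
Unset Strict Implicit.
Unset Printing Implicit Defensive.

Import Order.TTheory GRing.Theory Num.Theory.
Local Open Scope ring_scope.

(** * Roots of unity with two distinct traces *)

(** For natural exponents not both zero, the first equation forces [q < p] because [x < y], and the
    second forbids it because [N < M]. For exponents of opposite sign, one side of the first
    equation is at least 1 and the other is below 1. *)
Lemma exprz_eq_dependent (F : numFieldType) (x y M N : F) (p q : int) :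
  1 < x -> x < y -> 1 <= N -> N < M ->
  x ^ p = y ^ q -> M ^ p = N ^ q -> p = 0 /\ q = 0.
Proof.
move=> x1 xy N1 NM.
have y1 : 1 < y by apply: lt_trans xy.
have M1 : 1 < M by apply: le_lt_trans NM.
have nat_case (a b : nat) : x ^+ a = y ^+ b -> M ^+ a = N ^+ b -> a = 0%N /\ b = 0%N.
  move=> exy eMN; case: (leqP a b) => [ab|ba].
    case: a => [|a] in exy eMN ab *.
      split=> //; case: b => // b in exy eMN ab *.
      by have := exprn_egt1 b.+1 y1; rewrite -exy expr0 ltxx.
    have: x ^+ a.+1 < y ^+ b.
      apply: (@lt_le_trans _ _ (y ^+ a.+1)); last by rewrite ler_eXn2l.
      by rewrite ltrXn2r ?(le_trans ler01) // ltW.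
    by rewrite exy ltxx.
  have a0 : a != 0%N by lia.
  have: N ^+ b < M ^+ a.
    apply: (@le_lt_trans _ _ (N ^+ a)); first by rewrite ler_weXn2l // ltnW.
    by rewrite ltrXn2r // (le_trans ler01).
  by rewrite eMN ltxx.
have mixed (z t : F) (a b : nat) : 1 < z -> 1 <= t -> z ^+ a = (t ^+ b)^-1 -> a = 0%N.
  move=> z1 t1 e; case: a => // a in e *.
  have h : 1 < z ^+ a.+1 by rewrite exprn_egt1.
  rewrite e in h.
  have : (t ^+ b)^-1 <= 1 by rewrite invf_le1 ?exprn_ege1 // exprn_gt0 // (lt_le_trans ltr01).
  by move/(lt_le_trans h); rewrite ltxx.
case: p q => [a|a] [b|b].
- by rewrite -!exprnP => e1 e2; have [-> ->] := nat_case _ _ e1 e2.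
- rewrite NegzE -!exprnP -!exprnN => e1 e2.
  have := @mixed _ _ b.+1 a y1 (ltW x1).
  by rewrite e1 invrK => /(_ erefl).
- rewrite NegzE -!exprnP -!exprnN => e1 e2.
  have := @mixed _ _ a.+1 b x1 (ltW y1).
  by rewrite -e1 invrK => /(_ erefl).
rewrite !NegzE -!exprnN => /invr_inj e1 /invr_inj e2.
by have [] := nat_case _ _ e1 e2.
Qed.

Lemma norm_exprz (F : numFieldType) (x : F) (n : int) : `|x ^ n| = `|x| ^ n.
Proof. by case: n => n; rewrite ?NegzE -?exprnN -?exprnP ?normfV normrX. Qed.

(** Such a [j] is prime to [k] and not 1 or -1 modulo [k], so [zeta ^+ j] is a conjugate of [zeta]
    other than [zeta] and its inverse, and has a different trace. *)
Lemma coprime_middle k : (3 <= k)%N -> k \notin [:: 3; 4; 6]%N ->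
  exists j, [/\ coprime j k, (1 < j)%N & (j.+1 < k)%N].
Proof.
rewrite !inE => k3 /norP[n3 /norP[n4 n6]].
case ok: (odd k).
  by exists 2; rewrite coprime2n ok; split=> //; lia.
have [l kE] : exists l, k = (2 * l)%N by exists k./2; lia.
rewrite {}kE in k3 n3 n4 n6 ok *.
(* With [k = 2 l], the exponent is the first odd number above [l]. The bound [j + 1 < k] fails only
   for the excluded [k = 6] ([l] odd) and [k = 4] ([l] even). *)
case ol: (odd l).
  exists l.+2; split; [|lia|lia].
  rewrite coprimeMr coprimen2 /= negbK ol /=.
  by rewrite -addn2 /coprime gcdnC gcdnDl -/(coprime l 2) coprimen2 ol.
exists l.+1; split; [|lia|lia].
by rewrite coprimeMr coprimen2 /= ol coprimeSn.
Qed.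

Lemma norm_prim_root k (z : algC) : (0 < k)%N -> k.-primitive_root z -> `|z| = 1.
Proof.
move=> k0 /prim_expr_order zk.
by apply/eqP; rewrite -(@pexpr_eq1 _ _ k) // -normrX zk normr1.
Qed.

Lemma conj_norm1 (z : algC) : `|z| = 1 -> z^* = z^-1.
Proof. by move=> z1; rewrite invC_norm z1 expr1n invr1 mul1r. Qed.

Lemma norm_sub_int_sq (z : algC) (m : int) : `|z| = 1 ->
  `|- m%:~R + z| ^+ 2 = m%:~R ^+ 2 + 1 - m%:~R * (z + z^-1).
Proof.
move=> z1; have z0 : z != 0 by rewrite -normr_eq0 z1 oner_neq0.
rewrite normCK rmorphD rmorphN /= conj_Creal ?realz // conj_norm1 //.
by field; rewrite z0.
Qed.

Lemma add_inv_eq (F : fieldType) (x y : F) : x != 0 -> y != 0 ->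
  x + x^-1 = y + y^-1 -> y = x \/ y * x = 1.
Proof.
move=> x0 y0 e.
have : (y - x) * (y * x - 1) = 0.
  transitivity (x * y * ((y + y^-1) - (x + x^-1))); last by rewrite e subrr mulr0.
  by field; rewrite x0 y0.
move/eqP; rewrite mulf_eq0 => /orP[] /eqP /subr0_eq ->; by [left|right].
Qed.

Lemma two_traces_indep k (zeta : algC) (m n p q : int) :
  (3 <= k)%N -> k \notin [:: 3; 4; 6]%N -> k.-primitive_root zeta ->
  0 < n -> n < m ->
  (- m%:~R + zeta) ^ p = (- n%:~R + zeta) ^ q -> p = 0 /\ q = 0.
Proof.
move=> k3 kn prim n0 nm e.
have k0 : (0 < k)%N by apply: leq_trans k3.
have conj_eq j : coprime j k ->
    `|- m%:~R + zeta ^+ j| ^ p = `|- n%:~R + zeta ^+ j| ^ q.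
  (* The automorphism [u] raises [k]-th roots of unity to the power [j]. *)
  move=> cjk; have [u uE] := @Qn_aut_exists j k cjk.
  move/(congr1 u): e; rewrite !fmorphXz !rmorphD !rmorphN /= !rmorph_int.
  rewrite uE ?(prim_expr_order prim) // => /(congr1 Num.norm).
  by rewrite !norm_exprz.
have norm1 j : `|zeta ^+ j| = 1 by rewrite normrX (norm_prim_root k0 prim) expr1n.
have z0 j : zeta ^+ j != 0 by rewrite -normr_eq0 norm1 oner_neq0.
pose s j := zeta ^+ j + (zeta ^+ j)^-1.
pose A (l : int) j := l%:~R ^+ 2 + 1 - l%:~R * s j : algC.
have AE l j : `|- l%:~R + zeta ^+ j| ^+ 2 = A l j by apply: norm_sub_int_sq.
have sreal j : s j \is Num.real.
  by apply/CrealP; rewrite /s -conj_norm1 // rmorphD /= conjCK addrC.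
have A_gt0 l j : 0 < l -> coprime j k -> 0 < A l j.
  move=> l0 cjk; rewrite -AE exprn_gt0 // normr_gt0 addrC subr_eq0.
  apply/eqP => zl; have : `|zeta ^+ j| = l%:~R by rewrite zl ger0_norm // ler0z ltW.
  rewrite norm1 => l1; move: zl; rewrite -l1 => /eqP.
  rewrite -(prim_order_dvd prim) => kj.
  have : (k %| 1)%N by rewrite -(Gauss_dvdr 1 (n := j)) ?muln1 // coprime_sym.
  by rewrite dvdn1; lia.
have A_eq j : coprime j k -> A m j ^ p = A n j ^ q.
  by move=> /conj_eq ej; rewrite -!AE !exprnP !(exprzAC _ 2) ej.
have mnR : (n%:~R : algC) < m%:~R by rewrite ltr_int.
have nR : (1 : algC) <= n%:~R by rewrite ler1z; lia.
have m0 : 0 < m by apply: lt_trans nm.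
have A_lt l i j : 0 < l -> s i < s j -> A l j < A l i.
  by move=> l0 sij; rewrite /A ltrD2l ltrN2 ltr_pM2l // ltr0z.
have [j [cjk j1 jk]] := coprime_middle k3 kn.
have sne : s 1%N != s j.
  apply/eqP => /(add_inv_eq (z0 _) (z0 _)) [] /eqP.
    by rewrite (eq_prim_root_expr prim) !modn_small; lia.
  rewrite -exprD -(prim_order_dvd prim) => /dvdn_leq; lia.
have [i1 [i2 [c1 c2 s12]]] : exists i1 i2, [/\ coprime i1 k, coprime i2 k & s i1 < s i2].
  case/real_ltgtP: (sreal 1%N) (sreal j) (sne) => // sj _.
    by exists 1%N, j; rewrite coprime1n.
  by exists j, 1%N; rewrite coprime1n.
pose P (l : int) := \prod_(i < k | coprime i k) `|- l%:~R + zeta ^+ i|.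
have P_eq : P m ^ p = P n ^ q.
  have prodXz (r : int) (G : 'I_k -> algC) :
      (\prod_(i < k | coprime i k) G i) ^ r = \prod_(i < k | coprime i k) G i ^ r.
    by apply: (big_morph (fun x : algC => x ^ r)) => [x y|]; rewrite ?expfzMl ?exp1rz.
  rewrite /P !prodXz.
  by apply: eq_bigr => i /conj_eq.
(* [P n] is the absolute value of a cyclotomic polynomial at an integer, hence an integer; being
   nonzero, it is at least 1. *)
have PE : `|('Phi_k).[n]%:~R| = P n :> algC.
  rewrite -horner_map /= (Cintr_Cyclotomic prim) horner_prod normr_prod.
  by apply: eq_bigr => i _; rewrite hornerXsubC distrC addrC.
have P_ge1 : 1 <= P n.
  rewrite -PE norm_intr_ge1 // -normr_eq0 PE.
  apply/prodf_neq0 => i ci.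
  by have := A_gt0 n i n0 ci; rewrite -AE => /lt0r_neq0; rewrite expf_eq0.
have P_lt : P n < P m.
  apply: ltr_prod => [|i ci].
    have k1 : (1 < k)%N by apply: ltn_trans k3.
    by apply/hasP; exists (Ordinal k1); rewrite ?mem_index_enum //= coprime1n.
  rewrite normr_ge0 /= -(@ltr_pXn2r _ 2) ?nnegrE // !AE /A -subr_gt0.
  have -> : m%:~R ^+ 2 + 1 - m%:~R * s i - (n%:~R ^+ 2 + 1 - n%:~R * s i)
    = (m%:~R - n%:~R) * (m%:~R + n%:~R - s i) :> algC by ring.
  rewrite mulr_gt0 ?subr_gt0 //.
  have s_le2 : s i <= 2.
    apply: le_trans (real_ler_norm (sreal i)) _.
    by rewrite (le_trans (ler_normD _ _)) // normfV norm1 invr1.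
  apply: (le_lt_trans s_le2).
  have -> : 2 = 1 + 1 :> algC by [].
  by rewrite ltr_leD // (le_lt_trans nR).
apply: (@exprz_eq_dependent _ (A m i1 / A m i2) (A n i1 / A n i2) (P m) (P n)) => //.
- by rewrite ltr_pdivlMr ?mul1r ?A_lt ?A_gt0.
- rewrite ltr_pdivlMr ?A_gt0 // mulrAC ltr_pdivrMr ?A_gt0 // -subr_gt0.
  have -> : A n i1 * A m i2 - A m i1 * A n i2
     = (s i2 - s i1) * ((m%:~R - n%:~R) * (m%:~R * n%:~R - 1)) by rewrite /A; ring.
  rewrite !mulr_gt0 ?subr_gt0 // -intrM ltr1z.
  by nia.
- by rewrite !expfzMl !exprz_inv -!invr_expz !A_eq.
Qed.

(** * The rings Z[theta] *)

(* [(u, v) : quad c] stands for [u + v theta] with [theta^2 = c theta - 1]; the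
   alias keeps this product apart from the componentwise one on [int * int]. *)
Definition quad (c : int) : Type := (int * int)%type.

HB.instance Definition _ c := GRing.Zmodule.copy (quad c) (int * int)%type.

Definition quad_mul c (x y : quad c) : quad c :=
  (x.1 * y.1 - x.2 * y.2, x.1 * y.2 + x.2 * y.1 + c * (x.2 * y.2)).

Fact quad_mulA c : associative (@quad_mul c).
Proof. by move=> x y z; congr pair; rewrite /=; ring. Qed.
Fact quad_mulC c : commutative (@quad_mul c).
Proof. by move=> x y; congr pair; rewrite /=; ring. Qed.
Fact quad_mul1 c : left_id ((1, 0) : quad c) (@quad_mul c).
Proof. by move=> [u v]; congr pair; rewrite /=; ring. Qed.
Fact quad_mulDl c : left_distributive (@quad_mul c) +%R.
Proof. by move=> x y z; congr pair; rewrite /=; ring. Qed.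
Fact quad_one_neq0 c : ((1, 0) : quad c) != 0.
Proof. by []. Qed.

HB.instance Definition _ c := GRing.Zmodule_isComNzRing.Build (quad c)
  (@quad_mulA c) (@quad_mulC c) (@quad_mul1 c) (@quad_mulDl c) (@quad_one_neq0 c).

Definition theta c : quad c := (0, 1).

Lemma quadM c (x y : quad c) :
  x * y = (x.1 * y.1 - x.2 * y.2, x.1 * y.2 + x.2 * y.1 + c * (x.2 * y.2)).
Proof. by []. Qed.

Lemma quadD c (x y : quad c) : x + y = (x.1 + y.1, x.2 + y.2).
Proof. by []. Qed.

Lemma quadN c (x : quad c) : - x = (- x.1, - x.2).
Proof. by []. Qed.

Lemma quad_natr c n : n%:R = (n%:Z, 0) :> quad c.
Proof. by elim: n => // n IH; rewrite -addn1 natrD IH quadD /= addn1 addr0; congr pair; lia. Qed.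

Lemma quad_intr c (n : int) : n%:~R = (n, 0) :> quad c.
Proof. by case: n => n; rewrite ?NegzE ?mulrNz -pmulrn quad_natr // quadN /= oppr0. Qed.

(** * Truncated binomial expansions *)

Lemma expr_1D_mod (R : comNzRingType) (z : R) n :
  exists w, (1 + z) ^+ n = 1 + z * w.
Proof.
elim: n => [|n [w IH]]; first by exists 0; rewrite expr0; ring.
by exists (1 + w + z * w); rewrite exprS IH; ring.
Qed.

Lemma expr_1D_mod2 (R : comNzRingType) (z : R) n :
  exists w, (1 + z) ^+ n = 1 + n%:R * z + z ^+ 2 * w.
Proof.
elim: n => [|n [w IH]]; first by exists 0; rewrite expr0; ring.
by exists (n%:R + w + z * w); rewrite exprS IH -natr1; ring.
Qed.

(** Induction on [r]: each squaring doubles both the linear term and the error. The error exponent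
    starts from [2 * e - 1], not [2 * e], because the first squaring already creates the term
    [2 ^+ (2 * e) * y ^+ 2]. *)
Lemma expr_1D_2adic (R : comNzRingType) (y : R) e r s : (0 < e)%N ->
  exists w, (1 + 2 ^+ e * y) ^+ (2 ^ r * s) =
    1 + 2 ^+ (e + r) * s%:R * y + 2 ^+ (r + (2 * e).-1) * w.
Proof.
case: e => // e _; elim: r => [|r [w IH]].
  rewrite mul1n addn0 add0n; have [w ->] := expr_1D_mod2 (2 ^+ e.+1 * y) s.
  exists (2 * y ^+ 2 * w).
  have -> : (2 * e.+1).-1 = (e + e).+1 by lia.
  by rewrite !exprS exprD; ring.
rewrite expnS -mulnA mulnC exprM IH.
set A := s%:R * y; exists (w + 2 ^+ r * (A + 2 ^+ e * w) ^+ 2).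
rewrite -mulrA -/A.
have -> : (r + (2 * e.+1).-1 = r + e + e.+1)%N by lia.
have -> : (r.+1 + (2 * e.+1).-1 = r + e + e.+2)%N by lia.
have -> : (e.+1 + r.+1 = (r + e).+2)%N by lia.
have -> : (e.+1 + r = (r + e).+1)%N by lia.
rewrite !(exprS, exprD) -!mulrA -/A; ring.
Qed.

(** Conjugation sends [theta] to the other root [c - theta], which is also its inverse; the norm of
    [x] is the integer [x * quad_conj x]. *)
Definition quad_conj c (x : quad c) : quad c := (x.1 + c * x.2, - x.2).
Definition quad_norm c (x : quad c) : int := x.1 ^+ 2 + c * x.1 * x.2 + x.2 ^+ 2.

Lemma quad_conjM c : {morph @quad_conj c : x y / x * y}.
Proof. by move=> x y; rewrite /quad_conj !quadM /=; congr pair; ring. Qed.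

Lemma quad_conjX c n : {morph @quad_conj c : x / x ^+ n}.
Proof.
move=> x; elim: n => [|n IH]; last by rewrite !exprS quad_conjM IH.
by rewrite !expr0 /quad_conj mulr0 addr0 oppr0.
Qed.

Lemma quad_normM c : {morph @quad_norm c : x y / x * y}.
Proof. by move=> x y; rewrite /quad_norm quadM /=; ring. Qed.

Lemma quad_normX c n : {morph @quad_norm c : x / x ^+ n}.
Proof.
move=> x; elim: n => [|n IH]; last by rewrite !exprS quad_normM IH.
by rewrite !expr0 /quad_norm /= expr0n mulr0 !addr0 expr1n.
Qed.

Lemma quad_sndD c (x y : quad c) : (x + y).2 = x.2 + y.2.
Proof. by []. Qed.

Lemma snd_intrM c (n : int) (x : quad c) : (n%:~R * x).2 = n * x.2.
Proof. by rewrite quad_intr quadM /=; ring. Qed.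

Lemma snd_natrM c n (x : quad c) : (n%:R * x).2 = n%:Z * x.2.
Proof. by rewrite quad_natr quadM /=; ring. Qed.

Lemma theta_conj c : theta c * quad_conj (theta c) = 1.
Proof. by rewrite quadM /=; congr pair; ring. Qed.

(** [theta ^+ 2 = -1] for [c = 0], and [theta ^+ 3 = -1] for [c = 1]. *)
Lemma theta_red c g : c = 0 \/ c = 1 ->
  exists t r, theta c ^+ g = (-1) ^+ t * theta c ^+ r /\ ((r < 2)%N \/ r = 2%N /\ c = 1).
Proof.
case=> ->.
  exists (g %/ 2)%N, (g %% 2)%N; split; last by left; rewrite ltn_mod.
  by rewrite {1}(divn_eq g 2) exprD mulnC exprM.
exists (g %/ 3)%N, (g %% 3)%N; split; first by rewrite {1}(divn_eq g 3) exprD mulnC exprM.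
by have := ltn_pmod g (isT : 0 < 3)%N; lia.
Qed.

(** * 2-adic analysis of the [theta]-coordinate of powers *)

Lemma nat_2adic n : (0 < n)%N -> exists r s, n = (2 ^ r * s.*2.+1)%N.
Proof.
elim/ltn_ind: n => n IH n0; case on: (odd n).
  by exists 0, n./2; lia.
have [||r [s e]] := IH n./2; [lia|lia|].
by exists r.+1, s; rewrite expnS -mulnA -e; lia.
Qed.

Lemma int_2adic (x : int) : x != 0 -> exists r y, x = 2 ^+ r * (2 * y + 1).
Proof.
move=> x0; have [|r [s e]] := @nat_2adic `|x|; first by lia.
have {}e : `|x|%:Z = 2 ^+ r * (2 * s%:Z + 1).
  by rewrite e -!natz natrM natrX; congr (_ * _); rewrite !natz; lia.
have [x_ge0|x_lt0] := leP 0 x; first by exists r, s%:Z; rewrite -e; lia.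
by exists r, (- s%:Z - 1); have -> : x = - `|x|%:Z; [lia | rewrite e; ring].
Qed.

Lemma quad_natrX c (b n : nat) : b%:R ^+ n = ((b%:R ^+ n : int), 0) :> quad c.
Proof. by rewrite -natrX quad_natr -natz natrX. Qed.

(* With [sg = theta^-1], [theta^g (x + theta)^a = +- theta^r (1 + x sg)^a] for some
   [r <= 2].  For [r = 0] the coordinate is even.  For [r = 1] the term in [x]
   contributes nothing and the one in [x^2] dominates 2-adically.  For [r = 2] the
   coordinate is [1 + a x] modulo [x^2], so [x = +-2]; then [3] divides
   [(-2 + theta)^2], and the 4-periodicity modulo 8 of the powers of [1 + 2 sg]
   reduces [x = 2] to [a = 3 + 4 b], where first-order terms force [b = 0]. *)
Lemma even_shift_expr_snd1 c g (x : int) a :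
  c = 0 \/ c = 1 -> odd a -> (1 < a)%N -> x != 0 -> (2 %| x)%Z ->
  `|(theta c ^+ g * (x%:~R + theta c) ^+ a).2| = 1 -> [/\ c = 1, a = 3%N & x = 2].
Proof.
move=> c01 oa a1 x0 /dvdzP[x' xE].
set sg := quad_conj (theta c).
have -> : x%:~R + theta c = theta c * (1 + x%:~R * sg).
  rewrite mulrDr mulr1 mulrCA theta_conj; ring.
rewrite exprMn mulrA -exprD.
have [t [r [-> rcase]]] := theta_red (g + a) c01.
rewrite -mulrA -[(-1) ^+ t]signr_odd mulr_sign => h.
have {h} : `|(theta c ^+ r * (1 + x%:~R * sg) ^+ a).2| = 1.
  by case: (odd t) h => //; rewrite quadN /= normrN.
move=> h.
have [a' aE] : exists a', a = (2 * a').+1 by exists a./2; lia.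
case: r rcase h => [|[|[|r]]] rcase h; last by lia.
- have [w] := expr_1D_mod (x%:~R * sg) a.
  move=> e; rewrite e expr0 mul1r -mulrA quadD snd_intrM xE /= in h; nia.
- have [f [x1 x1E]] := int_2adic x0.
  case: f x1E => [|f] x1E; first by lia.
  have [|rr [s a'E]] := @nat_2adic a'; first by lia.
  pose K : int := 2 ^+ f; pose R : int := 2 ^+ rr; pose X := 2 * x1 + 1.
  have xK : x = 2 * K * X by rewrite x1E exprS.
  (* This is [X * sg + K * X ^+ 2 * sg ^+ 2] in coordinates, obtained from [2 * x = 4 * K * X] and
     [x ^+ 2 = 4 * K ^+ 2 * X ^+ 2]. *)
  pose y : quad c := (X * c + K * X ^+ 2 * (c ^+ 2 - 1), - X - K * X ^+ 2 * c).
  have e2 : (1 + x%:~R * sg) ^+ 2 = 1 + 2 ^+ f.+2 * y.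
    rewrite expr2 quad_intr quad_natrX !exprS -/K xK !quadM !quadD /=.
    by congr pair; ring.
  have [w lte] := @expr_1D_2adic _ y f.+2 rr s.*2.+1 isT.
  have : (theta c ^+ 1 * (1 + x%:~R * sg) ^+ a).2 =
     1 - 4 * K ^+ 2 * R * (s.*2.+1%:Z * X ^+ 2 - 2 *
        (X * s.*2.+1%:Z * y.2 + 2 * K * X * w.2 + w.1 + c * w.2)).
    rewrite expr1 aE exprS exprM e2 a'E lte !quad_natrX quad_natr quad_intr xK.
    have -> : (f.+2 + rr = (f + rr).+2)%N by lia.
    have -> : (rr + (2 * f.+2).-1 = (rr + (f + f)).+3)%N by lia.
    rewrite !exprS !exprD -/K -/R !quadM !quadD /=.
    by ring.
  set Z := X * _ * _ + _ + _ + _ => e; rewrite {}e in h.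
  (* The coordinate is 1 minus 4 times a nonzero integer, whose last factor is odd; so it is neither
     1 nor -1. *)
  have KR : K ^+ 2 * R != 0 by rewrite mulf_neq0 ?expf_neq0.
  have oE : s.*2.+1%:Z * X ^+ 2 - 2 * Z != 0.
    have -> : s.*2.+1%:Z * X ^+ 2 - 2 * Z =
        2 * (s%:Z * X ^+ 2 + 2 * x1 ^+ 2 + 2 * x1 - Z) + 1.
      have -> : s.*2.+1%:Z = 2 * s%:Z + 1 by lia.
      by rewrite /X; ring.
    lia.
  have := mulf_neq0 KR oE; rewrite -!mulrA in h *; lia.
have c1 : c = 1 by case: rcase => [|[]].
rewrite {}c1 in sg h *.
have sgE : sg = (1, -1) by [].
have [w e] := expr_1D_mod2 (x%:~R * sg) a.
pose u := (theta 1 ^+ 2 * sg ^+ 2 * w).2.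
have h2 : (theta 1 ^+ 2 * (1 + x%:~R * sg) ^+ a).2 = 1 + x * (a%:Z + x * u).
  rewrite e.
  have -> : theta 1 ^+ 2 * (1 + a%:R * (x%:~R * sg) + (x%:~R * sg) ^+ 2 * w) =
     theta 1 ^+ 2 + x%:~R * (a%:R * (theta 1 ^+ 2 * sg) + x%:~R * (theta 1 ^+ 2 * sg ^+ 2 * w)).
    by ring.
  have -> : theta 1 ^+ 2 * sg = theta 1 by [].
  rewrite !(quad_sndD, snd_intrM, snd_natrM) -/u (_ : (theta 1 ^+ 2).2 = 1) // (_ : (theta 1).2 = 1) //; lia.
have hx : x * (a%:Z + x * u) = -2.
  have : x * (a%:Z + x * u) = 0 \/ x * (a%:Z + x * u) = -2 by rewrite h2 in h; lia.
  case=> // /eqP; rewrite mulf_eq0 (negPf x0) /= xE => /eqP; nia.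
rewrite hx in h2.
have [x2|x2] : x = 2 \/ x = -2.
  have : x' * (a%:Z + x * u) = -1 by rewrite xE in hx *; lia.
  move=> /(congr1 absz) /eqP; rewrite abszM muln_eq1 => /andP[/eqP x'1 _].
  by rewrite xE; lia.
- split=> //.
  have y4 : (1 + x%:~R * sg) ^+ 4 = 1 + 2 ^+ 3 * ((-5, -2) : quad 1) by rewrite x2.
  have [b aE4] : exists b, a = (1 + 4 * b)%N \/ a = (3 + 4 * b)%N.
    by exists (a %/ 4)%N; lia.
  case: aE4 => aE4.
    (* Modulo 8 the power is [1 + 2 sg], so the coordinate is 3 modulo 8, whereas [h2] makes it
       -1. *)
    have [w'] := expr_1D_mod (2 ^+ 3 * ((-5, -2) : quad 1)) b.
    rewrite -y4 -exprM => e4; move: h2; rewrite aE4 exprD e4 quad_natrX quad_intr x2.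
    rewrite sgE expr1 /theta !expr2 !quadM !quadD /= !exprS expr0; lia.
  have [b0|b0] := posnP b; first by rewrite aE4 b0.
  have [r [s bE]] := nat_2adic b0.
  have [w'] := @expr_1D_2adic _ ((-5, -2) : quad 1) 3 r s.*2.+1 isT.
  rewrite -bE -y4 -exprM => e4.
  have e3 : theta 1 ^+ 2 * (1 + x%:~R * sg) ^+ 3 = (19, -1) by rewrite x2.
  have R0 : (2 : int) ^+ r != 0 by rewrite expf_neq0.
  move: h2; rewrite aE4 exprD mulrA e3 e4 !quad_natrX quad_natr (addnC r).
  rewrite !exprS quadM !quadD !quadM /=.
  set R := _ ^+ r in R0 *.
  (* The [theta]-coordinate of [(19, -1) * (-5, -2)] is -31. After division by [8 * R], an odd
     multiple of 31 would have to be divisible by 4. *)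
  move=> h2; have : R * (31 * s.*2.+1%:Z - 4 * (19 * w'.2 - w'.1 - w'.2)) = 0.
    by lia.
  by move/eqP; rewrite mulf_eq0 (negPf R0) /=; lia.
have [b aEb] : exists b, a = (2 + b)%N by exists (a - 2)%N; lia.
have sq : (1 + x%:~R * sg) ^+ 2 = 3 * ((-1, 0) : quad 1) by rewrite x2.
move: h2; rewrite aEb exprD sq -(mulrA 3) (mulrCA _ 3) snd_natrM; lia.
Qed.

Lemma shift_expr_snd1 c g (x : int) a : c = 0 \/ c = 1 -> odd a -> (1 < a)%N ->
  quad_norm (x%:~R + theta c) != 1 ->
  `|(theta c ^+ g * (x%:~R + theta c) ^+ a).2| = 1 ->
  [/\ c = 1, a = 3%N & x = 2 \/ x = -3].
Proof.
move=> c01 oa a1 N1 h.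
have NE : quad_norm (x%:~R + theta c) = x ^+ 2 + c * x + 1.
  by rewrite /quad_norm quad_intr quadD /=; ring.
rewrite {}NE in N1.
have [x_even|x_odd] := boolP (2 %| x)%Z.
  have x0 : x != 0 by apply: contraNneq N1 => ->; rewrite expr0n mulr0 !add0r.
  by have [-> -> ->] := even_shift_expr_snd1 c01 oa a1 x0 x_even h; split=> //; left.
case: (c01) => cE; subst c.
  (* When [theta ^+ 2 = -1] and [x] is odd, 2 divides [(x + theta) ^+ 2], so the coordinate is
     even. *)
  have [x' xE] : exists x', x = 2 * x' + 1 by exists (x %/ 2)%Z; lia.
  have [b aE] : exists b, a = (2 + b)%N by exists (a - 2)%N; lia.
  have sq : (x%:~R + theta 0) ^+ 2 = 2 * ((2 * x' ^+ 2 + 2 * x', x) : quad 0).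
    by rewrite quad_natr quad_intr quadD expr2 !quadM xE /=; congr pair; ring.
  move: h; rewrite aE exprD sq -(mulrA 2) (mulrCA _ 2) snd_natrM; lia.
(* Conjugation exchanges [x] and [- x - 1] up to sign, and flips parity. *)
have h' : `|(theta 1 ^+ (5 * g) * ((- x - 1)%:~R + theta 1) ^+ a).2| = 1.
  rewrite -[RHS]h -[RHS]normrN.
  have -> (z : quad 1) : - z.2 = (quad_conj z).2 by [].
  rewrite quad_conjM !quad_conjX exprM.
  have -> : theta 1 ^+ 5 = quad_conj (theta 1) by [].
  have -> : quad_conj (x%:~R + theta 1) = - ((- x - 1)%:~R + theta 1).
    by rewrite !quad_intr !quadD quadN /quad_conj /=; congr pair; ring.
  by rewrite exprNn -signr_odd oa mulrCA mulN1r quadN /= normrN.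
have y0 : - x - 1 != 0.
  by apply: contraNneq N1 => y0; have -> : x = -1 by lia.
have [|_ -> yE] := even_shift_expr_snd1 c01 oa a1 y0 _ h'; first by lia.
by split=> //; right; lia.
Qed.

(** * Units, cancellation and absorption of units into powers *)

Lemma theta12 c : c = 0 \/ c = 1 -> theta c ^+ 12 = 1.
Proof. by case=> ->. Qed.

Lemma quad_norm_eq0 c (x : quad c) : c = 0 \/ c = 1 -> quad_norm x = 0 -> x = 0.
Proof.
case: x => u v c01; rewrite /quad_norm /= => e.
have u0 : u = 0 by case: c01 e => -> e; nia.
have v0 : v = 0 by case: c01 e => -> e; nia.
by rewrite u0 v0.
Qed.

Lemma quad_norm_ge0 c (x : quad c) : c = 0 \/ c = 1 -> 0 <= quad_norm x.
Proof. by case: x => u v [] ->; rewrite /quad_norm /=; nia. Qed.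

Lemma quad_mulfI c (x y z : quad c) : c = 0 \/ c = 1 -> x != 0 ->
  x * y = x * z -> y = z.
Proof.
move=> c01 x0 e; apply/eqP; rewrite -subr_eq0; apply/eqP.
apply: (quad_norm_eq0 c01).
have : quad_norm x * quad_norm (y - z) = 0.
  by rewrite -quad_normM mulrBr e subrr /quad_norm /= mulr0.
move/eqP; rewrite mulf_eq0 => /orP[] /eqP // /(quad_norm_eq0 c01) x00.
by rewrite x00 eqxx in x0.
Qed.

Lemma theta_norm c g : quad_norm (theta c ^+ g) = 1.
Proof. by rewrite quad_normX /quad_norm /= expr0n mulr0 mul0r !add0r !expr1n. Qed.

(** Four times the norm is a square plus at least three times the square of either coordinate, so
    both coordinates lie between -1 and 1; the remaining candidates are checked one by one. *)
Lemma quad_unitP c (x : quad c) : c = 0 \/ c = 1 -> quad_norm x = 1 ->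
  exists g, x = theta c ^+ g.
Proof.
case: x => u v c01; rewrite /quad_norm /= => e.
have bound (w : int) : 3 * w ^+ 2 <= 4 -> -1 <= w <= 1.
  move=> w2; suff : `|w| <= 1 by lia.
  by rewrite -(@expr_le1 _ 2) // -normrX ger0_norm ?sqr_ge0 //; lia.
have [u1 v1] : -1 <= u <= 1 /\ -1 <= v <= 1.
  have := (sqr_ge0 u, sqr_ge0 v, sqr_ge0 (2 * u + v), sqr_ge0 (u + 2 * v)).
  by case: c01 e => -> e sq; split; apply: bound; case: sq => -[] [] *; lia.
have uE : u = -1 \/ u = 0 \/ u = 1 by lia.
have vE : v = -1 \/ v = 0 \/ v = 1 by lia.
case: c01 e => -> e; case: uE vE e => [|[]] -> [|[]] -> //= _;
  by [exists 0|exists 1|exists 2|exists 3|exists 4|exists 5].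
Qed.

Lemma unit_absorb c a g : c = 0 \/ c = 1 -> odd a -> (c = 1 -> ~~ (3 %| a)%N) ->
  exists i, theta c ^+ g = theta c ^+ (i * a).
Proof.
(* [a ^ 2] is 1 modulo the order of [theta]. *)
move=> c01 oa n3; exists (g * a)%N; rewrite -mulnA mulnC exprM; congr (_ ^+ _).
have [b aE] : exists b, a = (2 * b).+1 by exists a./2; lia.
case: c01 n3 => -> n3.
  have -> : (a * a = 4 * (b * b + b) + 1)%N by rewrite aE; nia.
  by rewrite exprD exprM (_ : theta 0 ^+ 4 = 1) // expr1n mul1r.
have [d dE] : exists d, (a * a = 6 * d + 1)%N.
  have := n3 erefl => {}n3.
  have [d [r [-> r15]]] : exists d r, a = (6 * d + r)%N /\ (r = 1%N \/ r = 5%N).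
    by exists (a %/ 6)%N, (a %% 6)%N; lia.
  case: r15 => ->; first by exists (6 * d * d + 2 * d)%N; nia.
  by exists (6 * d * d + 10 * d + 4)%N; nia.
by rewrite dE exprD exprM (_ : theta 1 ^+ 6 = 1) // expr1n mul1r.
Qed.

Lemma snd_expr_dvd c (x : quad c) n : exists t, (x ^+ n).2 = x.2 * t.
Proof.
elim: n => [|n [t IH]]; first by exists 0; rewrite mulr0.
exists (x.1 * t + (x ^+ n).1 + c * (x ^+ n).2).
by rewrite exprS quadM /= IH; ring.
Qed.

(** Once [theta ^+ g] is absorbed in [z], the [theta]-coordinate of [z] divides that of [z ^+ a], up
    to sign 1, so [z] is [x + theta] up to sign. If its norm were not 1, [shift_expr_snd1] would
    give [c = 1] and [a = 3], which is excluded. *)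
Lemma power_snd1_unit c g (z : quad c) a m : c = 0 \/ c = 1 -> odd a -> (1 < a)%N ->
  (c = 1 -> ~~ (3 %| a)%N) -> theta c ^+ g * z ^+ a = (m, 1) -> quad_norm z = 1.
Proof.
move=> c01 oa a1 n3; have [i ->] := unit_absorb g c01 oa n3.
have -> : quad_norm z = quad_norm (theta c ^+ i * z).
  by rewrite quad_normM theta_norm mul1r.
rewrite exprM -exprMn.
move: (_ * z) => {}z e; apply/eqP; apply: contraT => N1.
have [t] := snd_expr_dvd z a; rewrite e /= => z2t.
have z2 : `|z.2| = 1.
  have /eqP : absz (z.2 * t) = 1%N by rewrite -z2t.
  rewrite abszM muln_eq1 => /andP[/eqP zt _]; lia.
have [s [x zE]] : exists (s : bool) x, z = (-1) ^+ s * (x%:~R + theta c).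
  case: z z2 {N1 e z2t} => u v /= v1; have [->|->] : v = 1 \/ v = -1 by lia.
    by exists false, u; rewrite quad_intr quadD /= mul1r addr0.
  by exists true, (- u); rewrite quad_intr mulN1r quadD quadN /= addr0 opprK add0r.
have [] := @shift_expr_snd1 c 0 x a c01 oa a1.
- move: N1; rewrite zE quad_normM quad_normX.
  have -> : quad_norm (-1 : quad c) = 1 by rewrite /quad_norm /= oppr0 expr0n mulr0 !addr0.
  by rewrite expr1n mul1r.
- rewrite expr0 mul1r; move: e; rewrite zE exprMn -exprM.
  by rewrite -signr_odd mulr_sign; case: odd => [/(congr1 (fun w : quad c => - w))|->] //;
    rewrite opprK => ->.
by move=> c1 a3 _; move: n3; rewrite c1 a3 => /(_ erefl).
Qed.

(** * Extraction of a common root *)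

(** The root [T] is a parameter so that integrality can be tested at both conjugates [T] and
    [c - T]. *)
Definition quadC c (T : algC) (x : quad c) : algC := x.1%:~R + x.2%:~R * T.

Lemma quadCM c T (x y : quad c) : T ^+ 2 = c%:~R * T - 1 ->
  quadC T (x * y) = quadC T x * quadC T y.
Proof.
move=> TE; rewrite /quadC quadM /= !(rmorphB, rmorphD, rmorphM) /=.
have -> (a b d e : algC) : (a + b * T) * (d + e * T) =
  a * d + (a * e + b * d) * T + b * e * T ^+ 2 by ring.
by rewrite TE; ring.
Qed.

Lemma quadC1 c T : @quadC c T 1 = 1.
Proof. by rewrite /quadC /= mul0r addr0. Qed.

Lemma quadCX c T (x : quad c) n : T ^+ 2 = c%:~R * T - 1 ->
  quadC T (x ^+ n) = quadC T x ^+ n.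
Proof.
move=> TE; elim: n => [|n IH]; first by rewrite !expr0 quadC1.
by rewrite !exprS quadCM // IH.
Qed.

(** If [z] evaluates to 0, so does [z * quad_conj z], which is the integer [quad_norm z]. *)
Lemma quadC_inj c T : (c = 0 \/ c = 1) -> T ^+ 2 = c%:~R * T - 1 -> injective (@quadC c T).
Proof.
move=> c01 TE x y e; apply/eqP; rewrite -subr_eq0; apply/eqP/(quad_norm_eq0 c01).
set z := x - y.
have z0 : quadC T z = 0.
  transitivity (quadC T x - quadC T y); last by rewrite e subrr.
  by rewrite /quadC /z /= !rmorphB /=; ring.
apply/eqP; rewrite -(@intr_eq0 algC); apply/eqP.
transitivity (quadC T (z * quad_conj z)); last by rewrite quadCM // z0 mul0r.
rewrite /quadC /quad_conj /quad_norm quadM /=.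
have -> : z.1 * - z.2 + z.2 * (z.1 + c * z.2) + c * (z.2 * - z.2) = 0 by ring.
by rewrite mul0r addr0; congr (_%:~R); ring.
Qed.

(** * Integral closedness of [Z[theta]] *)

Lemma Aint_expr (z : algC) n : (0 < n)%N -> z ^+ n \in Aint -> z \in Aint.
Proof.
move=> n0 zn; apply: (@root_monic_Aint (minCpoly (z ^+ n) \Po 'X^n)).
- by rewrite rootE horner_comp hornerXn; apply: root_minCpoly.
- rewrite monicE lead_coef_comp ?size_polyXn // lead_coefXn expr1n mulr1.
  exact: minCpoly_monic.
- by rewrite polyOver_comp // rpredX // polyOverX.
Qed.

Lemma Aint_frac (a d : int) : d != 0 -> (a%:~R / d%:~R : algC) \in Aint ->
  exists b, a = b * d.
Proof.
move=> d0 aA; have dC0 : d%:~R != 0 :> algC by rewrite intr_eq0.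
have /intrP[b bE] : (a%:~R / d%:~R : algC) \in Num.int.
  by apply: Cint_rat_Aint aA; rewrite rpred_div // rpred_int.
exists b; apply/eqP; rewrite -(@eqr_int algC) rmorphM /= -bE divfK //.
Qed.

(* With [z = (u + v theta) / d], the integers [T1], [T2] and [n] are the trace of
   [z], the trace of [z theta] and the norm of [z]. *)
Lemma integral_coords (c u v d T1 T2 n : int) : c = 0 \/ c = 1 -> d != 0 ->
  2 * u + c * v = T1 * d -> c * u + (c ^+ 2 - 2) * v = T2 * d ->
  u ^+ 2 + c * u * v + v ^+ 2 = n * d ^+ 2 ->
  exists u' v', u = u' * d /\ v = v' * d.
Proof.
case=> -> d0 e1 e2 e3.
  have {}e1 : 2 * u = T1 * d by lia.
  have {}e2 : 2 * v = - T2 * d by lia.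
  have e : T1 ^+ 2 + T2 ^+ 2 = 4 * n.
    apply: (mulIf (expf_neq0 2 d0)).
    transitivity ((2 * u) ^+ 2 + (2 * v) ^+ 2); first by rewrite e1 e2; ring.
    by rewrite -(mulrA 4) -e3; ring.
  (* Two squares whose sum is divisible by 4 are both even. *)
  have [t1 [t2 [tE1 tE2]]] : exists t1 t2, T1 = 2 * t1 /\ T2 = 2 * t2.
    exists (T1 %/ 2)%Z, (T2 %/ 2)%Z.
    have [r1 r2] : (T1 %% 2 = 0 \/ T1 %% 2 = 1)%Z /\ (T2 %% 2 = 0 \/ T2 %% 2 = 1)%Z by lia.
    move: (divz_eq T1 2) (divz_eq T2 2) e.
    move: (T1 %/ 2)%Z (T2 %/ 2)%Z => a b.
    by case: r1 => ->; case: r2 => -> -> -> ; rewrite !expr2; lia.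
  by exists t1, (- t2); split; lia.
(* For [c = 1], solving the trace equations costs a factor 3; the norm equation recovers it by
   making [(T1 + T2) ^+ 2] divisible by 3. *)
have f1 : 3 * u = (T1 + T2) * d by lia.
have f2 : 3 * v = (T1 - 2 * T2) * d by lia.
have e : (T1 + T2) ^+ 2 = 3 * (n + (T1 + T2) * T2 - T2 ^+ 2).
  have : 9 * n = 3 * (T1 + T2) ^+ 2 - 9 * (T1 + T2) * T2 + 9 * T2 ^+ 2.
    apply: (mulIf (expf_neq0 2 d0)).
    transitivity ((3 * u) ^+ 2 + (3 * u) * (3 * v) + (3 * v) ^+ 2).
      by rewrite -(mulrA 9) -e3; ring.
    by rewrite f1 f2; ring.
  lia.
have [t tE] : exists t, T1 + T2 = 3 * t.
  exists ((T1 + T2) %/ 3)%Z; move: e (divz_eq (T1 + T2) 3).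
  have : ((T1 + T2) %% 3 = 0 \/ (T1 + T2) %% 3 = 1 \/ (T1 + T2) %% 3 = 2)%Z by lia.
  move: (_ - T2 ^+ 2) ((T1 + T2) %/ 3)%Z => a b r e E; move: e; rewrite E.
  by case: r => [|[]] ->; rewrite expr2; lia.
by exists t, (t - T2); split; lia.
Qed.

Lemma quad_expf_neq0 c (x : quad c) n : c = 0 \/ c = 1 -> x != 0 -> x ^+ n != 0.
Proof.
move=> c01 x0; apply: contraNneq x0 => /(congr1 (@quad_norm c)).
rewrite quad_normX [RHS]/quad_norm /= expr0n mulr0 !addr0 => /eqP.
by rewrite expf_eq0 => /andP[_ /eqP /(quad_norm_eq0 c01) ->].
Qed.

Lemma quadC_Aint c (T : algC) (x : quad c) : c = 0 \/ c = 1 -> T ^+ 2 = c%:~R * T - 1 ->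
  quadC T x \in Aint.
Proof.
move=> c01 TE; rewrite /quadC rpredD ?Aint_int // rpredM ?Aint_int //.
apply: (@Aint_unity_root 12) => //; apply/unity_rootP.
have {1}<- : quadC T (theta c) = T by rewrite /quadC /= add0r mul1r.
by rewrite -quadCX // theta12 // quadC1.
Qed.

(* [Z[theta]] is integrally closed: [y / x] is an algebraic integer because its
   [n]-th power is. *)
Lemma quad_dvd_of_expr c (T : algC) (x y w : quad c) n : c = 0 \/ c = 1 ->
  T ^+ 2 = c%:~R * T - 1 -> (0 < n)%N -> x != 0 -> x ^+ n * w = y ^+ n ->
  exists z, y = x * z.
Proof.
move=> c01 TE n0 x0 e; set N := quad_norm x.
have N0 : N != 0 by apply: contraNneq x0 => /(quad_norm_eq0 c01) ->.
have xxE : x * quad_conj x = N%:~R.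
  by rewrite quad_intr /N /quad_norm /quad_conj quadM /=; congr pair; ring.
set v := y * quad_conj x.
have vn : v ^+ n = N%:~R ^+ n * w.
  by rewrite /v exprMn -e mulrAC -exprMn xxE.
have NC0 : N%:~R != 0 :> algC by rewrite intr_eq0.
have A_int S : S ^+ 2 = c%:~R * S - 1 -> quadC S v / N%:~R \in Aint.
  move=> SE; apply: (Aint_expr n0); rewrite exprMn -quadCX // vn quadCM // quadCX //.
  have -> : quadC S (N%:~R : quad c) = N%:~R by rewrite quad_intr /quadC mul0r addr0.
  by rewrite mulrAC exprVn divff ?expf_neq0 // mul1r quadC_Aint.
(* [T'] is the other root. The quotient [y / x] equals [v / N]; its values at [T] and [T'] are both
   integral, and so are the traces and the norm formed from them. *)
pose T' := c%:~R - T.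
have TE' : T' ^+ 2 = c%:~R * T' - 1.
  by rewrite /T' sqrrB TE; ring.
have aT := A_int _ TE; have aT' := A_int _ TE'.
have T_Aint S : S ^+ 2 = c%:~R * S - 1 -> S \in Aint.
  by move=> SE; have := quadC_Aint (theta c) c01 SE; rewrite /quadC /= add0r mul1r.
have [T1 e1] : exists T1, 2 * v.1 + c * v.2 = T1 * N.
  apply: Aint_frac => //; 
  suff <- : quadC T v / N%:~R + quadC T' v / N%:~R = (2 * v.1 + c * v.2)%:~R / N%:~R.
    by rewrite rpredD.
  by rewrite -mulrDl /quadC /T' !(rmorphD, rmorphM) /=; congr (_ / _); ring.
have [T2 e2] : exists T2, c * v.1 + (c ^+ 2 - 2) * v.2 = T2 * N.
  apply: Aint_frac => //.
  suff <- : quadC T v / N%:~R * T + quadC T' v / N%:~R * T' =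
      (c * v.1 + (c ^+ 2 - 2) * v.2)%:~R / N%:~R.
    by rewrite rpredD // rpredM // T_Aint.
  rewrite mulrAC [_ / _ * T']mulrAC -mulrDl; congr (_ / _).
  rewrite /quadC !mulrDl -!mulrA -!expr2 TE TE' /T'.
  by rewrite !(rmorphB, rmorphD, rmorphM, rmorphXn) /=; ring.
have [m e3] : exists m, v.1 ^+ 2 + c * v.1 * v.2 + v.2 ^+ 2 = m * N ^+ 2.
  apply: Aint_frac; first by rewrite expf_neq0.
  suff <- : quadC T v / N%:~R * (quadC T' v / N%:~R) =
      (v.1 ^+ 2 + c * v.1 * v.2 + v.2 ^+ 2)%:~R / (N ^+ 2)%:~R.
    by rewrite rpredM.
  rewrite mulrACA -invfM -expr2 rmorphXn /=; congr (_ / _).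
  rewrite /quadC /T'.
  transitivity (v.1%:~R ^+ 2 + c%:~R * v.1%:~R * v.2%:~R + v.2%:~R ^+ 2 * (c%:~R * T - T ^+ 2) : algC).
    by ring.
  by rewrite TE !(rmorphD, rmorphM, rmorphXn) /=; ring.
have [a [b [aE bE]]] := integral_coords c01 N0 e1 e2 e3.
exists (a, b); apply: (@quad_mulfI _ (quad_conj x)) => //.
  apply: contraNneq x0 => xc0; apply/eqP/(quad_norm_eq0 c01).
  have : x * quad_conj x = 0 by rewrite xc0 mulr0.
  by rewrite xxE quad_intr => /(congr1 fst).
rewrite mulrC -/v mulrCA mulrA xxE quad_intr quadM /= mulrC (mulrC N).
by rewrite [LHS]surjective_pairing aE bE; congr pair; ring.
Qed.

(** As [theta ^+ 12 = 1], the exponent [11 * g] gives the inverse with natural exponents only. *)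
Lemma theta_inv c g : c = 0 \/ c = 1 -> theta c ^+ (11 * g) * theta c ^+ g = 1.
Proof. by move=> c01; rewrite -exprD (_ : 11 * g + g = 12 * g)%N ?exprM ?theta12 ?expr1n //; lia. Qed.

(* Euclid's algorithm on the exponents: if [p < q] then [y] divides [x], and
   [x = y z] gives [z ^+ p = theta ^+ i * y ^+ (q - p)]. *)
Lemma common_root c (T : algC) p q i (x y : quad c) : c = 0 \/ c = 1 ->
  T ^+ 2 = c%:~R * T - 1 -> (0 < p)%N -> (0 < q)%N -> x != 0 -> y != 0 ->
  x ^+ p = theta c ^+ i * y ^+ q ->
  exists a b j k z, [/\ coprime a b, (a * p = b * q)%N,
    x = theta c ^+ j * z ^+ a & y = theta c ^+ k * z ^+ b].
Proof.
move=> c01 TE; have [n] := ubnP (p + q).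
elim: n => // n IH in p q i x y *; rewrite ltnS => pqn p0 q0 x0 y0 e.
have inv_i := theta_inv i c01.
case: (ltngtP p q) => pq.
- have e1 : y ^+ p * (theta c ^+ i * y ^+ (q - p)) = x ^+ p.
    by rewrite e mulrCA -exprD subnKC // ltnW.
  have [z xE] := quad_dvd_of_expr c01 TE p0 y0 e1.
  have z0 : z != 0 by apply: contraNneq x0 => z0; rewrite xE z0 mulr0.
  have ze : z ^+ p = theta c ^+ i * y ^+ (q - p).
    apply: (@quad_mulfI _ (y ^+ p)) => //; last by rewrite e1 xE exprMn.
    exact: quad_expf_neq0.
  have [||a [b [j [k [g [cab ab zE yE]]]]]] := IH _ _ _ _ _ _ p0 _ z0 y0 ze; try lia.
  exists (a + b)%N, b, (j + k)%N, k, g; split=> //.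
  + by rewrite /coprime gcdnC gcdnDr gcdnC.
  + by nia.
  + by rewrite xE zE {1}yE !exprD; ring.
- have e1 : x ^+ q * (x ^+ (p - q) * theta c ^+ (11 * i)) = y ^+ q.
    by rewrite mulrA -exprD subnKC ?(ltnW pq) // e mulrAC (mulrC (theta c ^+ i)) inv_i mul1r.
  have [z yE] := quad_dvd_of_expr c01 TE q0 x0 e1.
  have z0 : z != 0 by apply: contraNneq y0 => z0; rewrite yE z0 mulr0.
  have ze : x ^+ (p - q) = theta c ^+ i * z ^+ q.
    apply: (@quad_mulfI _ (x ^+ q)) => //; first exact: quad_expf_neq0.
    by rewrite mulrCA -exprMn -yE -e -exprD subnKC // ltnW.
  have [||a [b [j [k [g [cab ab xE zE]]]]]] := IH _ _ _ _ _ _ _ q0 x0 z0 ze; try lia.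
  exists a, (a + b)%N, j, (j + k)%N, g; split=> //.
  + by rewrite /coprime gcdnDl.
  + by nia.
  + by rewrite yE zE {1}xE !exprD; ring.
(* Equal exponents end the descent: [x / y] has norm 1, hence is a power of [theta], and [y] itself
   is the common root. *)
- subst q; have [z xE] := quad_dvd_of_expr c01 TE p0 y0 (etrans (mulrC _ _) (esym e)).
  have zp : z ^+ p = theta c ^+ i.
    apply: (@quad_mulfI _ (y ^+ p)) => //; first exact: quad_expf_neq0.
    by rewrite -exprMn -xE e mulrC.
  have [j zE] : exists j, z = theta c ^+ j.
    apply: quad_unitP => //; apply/eqP.
    by rewrite -(@pexpr_eq1 _ _ p) ?quad_norm_ge0 // -quad_normX zp theta_norm.
  by exists 1, 1, j, 0, y; split; rewrite ?xE ?zE ?expr1 ?mul1r // mulrC.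
Qed.

Lemma quad_indep c (T : algC) (m n : int) p q i : c = 0 \/ c = 1 ->
  T ^+ 2 = c%:~R * T - 1 -> 0 < n -> n < m ->
  (m%:~R + theta c) ^+ p = theta c ^+ i * (n%:~R + theta c) ^+ q ->
  p = 0%N /\ q = 0%N.
Proof.
move=> c01 TE n0 nm e.
have NE (l : int) : quad_norm (l%:~R + theta c) = l ^+ 2 + c * l + 1.
  by rewrite /quad_norm quad_intr quadD /=; ring.
pose N (l : int) := l ^+ 2 + c * l + 1.
have N1 : 1 < N n by rewrite /N; case: c01 => ->; nia.
have NM : N n < N m by rewrite /N; case: c01 => ->; nia.
have eN : N m ^+ p = N n ^+ q.
  have := congr1 (@quad_norm c) e.
  by rewrite quad_normM theta_norm mul1r !quad_normX !NE.
have neq0 l : 0 < l -> (l%:~R + theta c) != 0.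
  by move=> l0; apply/eqP => /(congr1 snd); rewrite quad_intr.
have [p_eq0|p0] := posnP p.
  have [q_eq0|q0] := posnP q; first by [].
  have : 1 < N n ^+ q by rewrite exprn_egt1 // -lt0n.
  by rewrite -eN p_eq0 expr0 ltxx.
have pq : (p < q)%N.
  rewrite ltnNge; apply/negP => qp.
  have : N n ^+ q < N m ^+ p.
    apply: (@le_lt_trans _ _ (N n ^+ p)).
      by rewrite ler_weXn2l // ltW.
    by rewrite ltrXn2r // -?lt0n //; lia.
  by rewrite eN ltxx.
have [|a [b [j [k [z [cab ab xE yE]]]]]] :=
  common_root c01 TE p0 (leq_ltn_trans (leq0n _) pq) (neq0 m _) (neq0 n n0) e.
  exact: lt_trans nm.
have b_gt0 : (0 < b)%N.
  by case: b cab ab {yE} => // cab ab; case: a cab ab {xE} => // a _; nia.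
have ba : (b < a)%N.
  rewrite ltnNge; apply/negP => a_le_b.
  have : (a * p < b * q)%N by rewrite (leq_ltn_trans (leq_mul a_le_b (leqnn p))) ?ltn_pmul2l.
  by rewrite ab ltnn.
(* For even [d] the norm [l ^+ 2 + c * l + 1] would be a square strictly between [l ^+ 2] and
   [(l + 1) ^+ 2]. *)
have odd_exp (l : int) g d : 0 < l -> l%:~R + theta c = theta c ^+ g * z ^+ d -> odd d.
  move=> l0 lE; apply: contraT => /negbTE ed; set s := quad_norm z ^+ d./2.
  have sE : l ^+ 2 + c * l + 1 = s ^+ 2.
    rewrite -NE lE quad_normM theta_norm mul1r quad_normX -exprM.
    by congr (_ ^+ _); lia.
  have s0 : 0 <= s by rewrite exprn_ge0 // quad_norm_ge0.
  have l_lt_s : l < s.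
    by rewrite -(@ltr_pXn2r _ 2) ?nnegrE ?(ltW l0) // -sE; case: c01 => ->; lia.
  have s_lt : s < l + 1.
    rewrite -(@ltr_pXn2r _ 2) ?nnegrE // ?addr_ge0 ?(ltW l0) // -sE sqrrD1.
    by case: c01 => ->; lia.
  lia.
have oa := odd_exp _ _ _ (lt_trans n0 nm) xE.
have ob := odd_exp _ _ _ n0 yE.
have z1 : quad_norm z != 1.
  apply/eqP => z1; have := NE n; rewrite yE quad_normM theta_norm quad_normX z1.
  by rewrite expr1n mul1r => N1'; rewrite /N -N1' ltxx in N1.
have a1 : (1 < a)%N by lia.
have ml (l : int) : l%:~R + theta c = (l, 1) by rewrite quad_intr quadD /= addr0.
have not_unit d g l : odd d -> (1 < d)%N -> l%:~R + theta c = theta c ^+ g * z ^+ d ->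
    c = 1 /\ (3 %| d)%N.
  move=> od d1 lE; have [//|n3] : c = 1 /\ (3 %| d)%N \/ (c = 1 -> ~~ (3 %| d)%N).
    by case: c01 => ->; [right|have [|] := boolP (3 %| d)%N; [left|right]].
  by rewrite (power_snd1_unit c01 od d1 n3 (etrans (esym lE) (ml l))) eqxx in z1.
have [c1 a3] := not_unit _ _ _ oa a1 xE.
have b1 : b = 1%N.
  have [|b1|//] := ltngtP b 1; first by rewrite ltnNge b_gt0.
  have [_ b3] := not_unit _ _ _ ob b1 yE.
  have : (3 %| gcdn a b)%N by rewrite dvdn_gcd a3.
  by rewrite (eqP cab).
rewrite {}b1 expr1 in yE; subst c.
have {}xE : (m, 1) = theta 1 ^+ (j + 11 * k * a) * (n%:~R + theta 1) ^+ a.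
  have zE : z = theta 1 ^+ (11 * k) * (n%:~R + theta 1).
    by rewrite yE mulrA theta_inv // mul1r.
  by rewrite -ml xE {1}zE exprMn mulrA -exprM -exprD.
have [||_ a3E n2] := @shift_expr_snd1 1 (j + 11 * k * a) n a c01 oa a1.
- by rewrite NE gt_eqF.
- by rewrite -xE.
have {n2} n2 : n = 2 by lia.
have cube : (n%:~R + theta 1) ^+ 3 = (1, 18) by rewrite n2.
(* Multiplying [(1, 18)] by 1, [theta], [theta ^+ 2] gives [(1, 18)], [(-18, 19)], [(-19, 1)]. Up to
   sign, only the last can have second coordinate 1, and then [m = -19]. *)
have [t [r [tE r2]]] := theta_red (j + 11 * k * a) c01.
move: xE; rewrite tE a3E cube -signr_odd -mulrA mulr_sign.
have m0 := lt_trans n0 nm.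
case: r r2 {tE} => [|[|[|r]]] r2; rewrite ?expr0 ?expr1 ?expr2 ?quadM /=; last by lia.
all: case: (odd t) => /[dup] /(congr1 fst) /= + /(congr1 snd) /=; lia.
Qed.

(** * The theorem *)

(** Squaring the equation removes the minus signs, and injectivity of [quadC] carries it to
    [Z[theta]]. For exponents of opposite sign, a product of norms, all exceeding 1 as bases, would
    equal 1. *)
Lemma imaginary_quadratic_indep c (T : algC) (m n p q : int) : c = 0 \/ c = 1 ->
  T ^+ 2 = c%:~R * T - 1 -> 0 < n -> n < m ->
  (- (m%:~R + T)) ^ p = (- (n%:~R + T)) ^ q -> p = 0 /\ q = 0.
Proof.
move=> c01 TE n0 nm.
pose x (l : int) : quad c := l%:~R + theta c.
have xE (l : int) : - (l%:~R + T) = - quadC T (x l).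
  by rewrite /quadC /x quad_intr quadD /= addr0 add0r mul1r.
have Nx (l : int) : 0 < l -> 1 < quad_norm (x l).
  by move=> l0; rewrite /quad_norm /x quad_intr quadD /=; case: c01 => ->; nia.
have x0 (l : int) : 0 < l -> - quadC T (x l) != 0.
  move=> l0; rewrite oppr_eq0; apply/eqP => e.
  have : x l = 0 by apply: (quadC_inj c01 TE); rewrite e /quadC /= mul0r addr0.
  by move=> xl; have := Nx l l0; rewrite xl /quad_norm /= mulr0.
have sq l a : ((- quadC T (x l)) ^+ a) ^+ 2 = quadC T (x l ^+ (a * 2)).
  by rewrite -exprM exprNn mulnC exprM sqrrN expr1n expr1n mul1r quadCX.
have m0 := lt_trans n0 nm.
have nat_case a b : (- quadC T (x m)) ^+ a = (- quadC T (x n)) ^+ b -> a = 0%N /\ b = 0%N.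
  move/(congr1 (fun z => z ^+ 2)); rewrite !sq => /(quadC_inj c01 TE) e.
  by have [] := @quad_indep c T m n (a * 2) (b * 2) 0 c01 TE n0 nm; [rewrite mul1r | lia].
have mixed l l' a b : 0 < l -> 0 < l' ->
    (- quadC T (x l)) ^+ a = ((- quadC T (x l')) ^+ b.+1)^-1 -> False.
  move=> l0 l'0 e.
  have {}e : (- quadC T (x l)) ^+ a * (- quadC T (x l')) ^+ b.+1 = 1.
    by rewrite e mulVf // expf_neq0 // x0.
  move/(congr1 (fun z => z ^+ 2)): e; rewrite exprMn !sq expr1n -quadCM // -(quadC1 c T).
  move=> /(quadC_inj c01 TE) /(congr1 (@quad_norm c)); rewrite quad_normM !quad_normX.
  rewrite [RHS](_ : _ = 1); last by rewrite /quad_norm /= mulr0.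
  have A1 : 1 <= quad_norm (x l) ^+ (a * 2) by rewrite exprn_ege1 // ltW ?Nx.
  have B1 : 1 < quad_norm (x l') ^+ (b.+1 * 2) by rewrite exprn_egt1 ?Nx.
  by apply/eqP; rewrite gt_eqF // (lt_le_trans B1) // ler_peMl // ltW // (lt_trans ltr01).
rewrite !xE; case: p q => [a|a] [b|b].
- by rewrite -!exprnP => /nat_case [-> ->].
- by rewrite NegzE -exprnN -exprnP => /mixed -/(_ m0 n0).
- by rewrite NegzE -exprnN -exprnP => /esym /mixed -/(_ n0 m0).
by rewrite !NegzE -!exprnN => /invr_inj /nat_case [].
Qed.

(** For [k = 6] the value [n = 1] has to be avoided: [-1 + zeta = zeta ^+ 2] is a root of unity. *)
Lemma root_of_unity_indep k (zeta : algC) (m n : int) :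
  (3 <= k)%N -> k.-primitive_root zeta -> 0 < n -> n < m -> (k = 6%N -> 1 < n) ->
  mult_independent (- m%:~R + zeta) (- n%:~R + zeta).
Proof.
move=> k3 prim n0 nm n1.
have zA : zeta \in Aint by apply: Aint_prim_root prim.
split; try by rewrite rpredD // rpredN Aint_int.
move=> p q; have [k_small|k_big] := boolP (k \in [:: 3; 4; 6]%N); last first.
  exact: (two_traces_indep k3 k_big prim n0 nm).
have zk := prim_expr_order prim.
have zn j : (0 < j < k)%N -> zeta ^+ j - 1 != 0.
  move=> jk; rewrite subr_eq0 -(prim_order_dvd prim); apply/negP => /dvdn_leq; lia.
move: k_small; rewrite !inE => /or3P[] /eqP kE; rewrite {}kE in zk zn n1.
- have z2 : zeta ^+ 2 + zeta + 1 = 0.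
    apply: (mulfI (zn 1%N isT)); rewrite mulr0 expr1.
    by transitivity (zeta ^+ 3 - 1); [ring | rewrite zk subrr].
  have E (l : int) : - l%:~R + zeta = - (l%:~R + - zeta) by ring.
  rewrite !E; apply: (@imaginary_quadratic_indep 1) => //; first by right.
  by rewrite sqrrN mul1r -[RHS]addr0 -z2; ring.
- have z2 : zeta ^+ 2 + 1 = 0.
    apply: (mulfI (zn 2%N isT)); rewrite mulr0.
    by transitivity (zeta ^+ 4 - 1); [ring | rewrite zk subrr].
  have E (l : int) : - l%:~R + zeta = - (l%:~R + - zeta) by ring.
  rewrite !E; apply: (@imaginary_quadratic_indep 0) => //; first by left.
  by rewrite sqrrN mul0r sub0r; apply/eqP; rewrite -addr_eq0 z2.
have z2 : zeta ^+ 2 - zeta + 1 = 0.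
  have zp1 : zeta + 1 != 0.
    by apply: contraNneq (zn 2%N isT) => z1; rewrite subr_sqr_1 z1 mulr0.
  apply: (mulfI (mulf_neq0 (zn 3%N isT) zp1)); rewrite mulr0.
  by transitivity (zeta ^+ 6 - 1); [ring | rewrite zk subrr].
(* Here [-zeta] has trace -1, so the root of trace 1 used instead is [1 - zeta], the inverse of
   [zeta]. This shifts [l] to [l - 1], which stays positive because [1 < n]. *)
have E (l : int) : - l%:~R + zeta = - ((l - 1)%:~R + (1 - zeta)) by rewrite rmorphB /=; ring.
rewrite !E; apply: (@imaginary_quadratic_indep 1); [by right| |lia|lia].
by rewrite mul1r -[RHS]addr0 -z2; ring.
Qed.

Theorem theorem2 :
  (exists C : nat -> nat,
     effectively_computable C /\
     forall (k : nat) (zeta : algC),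
       (3 <= k)%N -> k.-primitive_root zeta ->
       forall m n : int, (C k)%:Z < n -> n < m ->
         mult_independent (- m%:~R + zeta) (- n%:~R + zeta)) /\
  (forall (k : nat) (zeta : algC),
     (3 <= k)%N -> k.-primitive_root zeta ->
     (exists b e : nat,
        b \in [:: 2; 3; 5; 6; 7; 11; 13; 17; 19; 23]%N /\ k = (b ^ e)%N) ->
     (k <> 6%N -> forall m n : int, 0 < n -> n < m ->
        mult_independent (- m%:~R + zeta) (- n%:~R + zeta)) /\
     (k = 6%N -> forall m n : int, 1 < n -> n < m ->
        mult_independent (- m%:~R + zeta) (- n%:~R + zeta))).
Proof.
split.
  (* Any bound at least 1 works; the identity is a projection, hence recursive. *)
  exists id; split; first exact: (recursive_proj ord0).
  by move=> k zeta k3 prim m n kn nm; apply: (root_of_unity_indep k3 prim); lia.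
move=> k zeta k3 prim _; split=> k6 m n n0 nm; apply: (root_of_unity_indep k3 prim) => //.
exact: lt_trans n0.
Qed.
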